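(* Let $\Omega=(G,\mathcal{B})$ be a biased graph with underlying finite graph $G=(V,E)$, and write its balanced Tutte polynomial as $T_{\Omega}^b(x,y)=\sum_{i,j\ge 0}t_{ij}x^iy^j$. For $0\le n\le |E|$ let $b_n:=\#\{A\in\mathcal{C}_{\Omega}:|A|=n\}$ be the number of balanced edge sets of size $n$. Then, for all integers $k\ge 0$, \[ \sum_{i=0}^{k}\sum_{j=0}^{k-i}\binom{k-i}{j}(-1)^jt_{ij}=\sum_{n=0}^{|E|}(-1)^{|V|-c(E)+n}b_n\binom{k+n-|V|+c(E)}{k}. \]
   Context: Let $G=(V,E)$ be a finite graph. A closed path is called a cycle, and its edge set is called a circle. A theta graph is the union of three internally disjoint open paths with the same two endpoints. A biased graph $\Omega=(G,\mathcal{B})$ consists of a graph $G$ and a class $\mathcal{B}$ of circles in $G$ (the balanced circles) satisfying the theta property: if two circles of a theta graph (contained in $G$) belong to $\mathcal{B}$, then so does the third. An edge set $A\subseteq E$ is balanced if every circle contained in it is balanced; $\mathcal{C}_{\Omega}$ is the collection of balanced edge sets. For $A\subseteq E$, $c(A)$ is the number of connected components of the spanning subgraph $(V,A)$. The rank function is $r_{\Omega}(A):=|V|-c(A)$ for $A\in\mathcal{C}_{\Omega}$, and $r(\Omega):=\max\{r_{\Omega}(A):A\in\mathcal{C}_{\Omega}\}$, which equals $|V|-c(E)$. Balanced Tutte polynomial: $T_{\Omega}^b(x,y):=\sum_{A\in\mathcal{C}_{\Omega}}(x-1)^{r(\Omega)-r_{\Omega}(A)}(y-1)^{|A|-r_{\Omega}(A)}$.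 Binomial convention: for integers $a,b$, $\binom{a}{b}=\frac{a(a-1)\cdots(a-b+1)}{b!}$ if $b\ge 0$ (also for negative $a$), and $\binom{a}{b}=0$ if $b<0$. *)

(* Defs.v *)
From mathcomp Require Import all_boot all_order all_algebra.

Set Implicit Arguments.
Unset Strict Implicit.
Unset Printing Implicit Defensive.

Import GRing.Theory.
Local Open Scope ring_scope.

(* Finite graphs, possibly with loops and parallel edges.  A loop is an edge
   whose set of ends is a singleton. *)
Record mgraph := MGraph {
  vertex : finType;
  edge : finType;
  ends : edge -> {set vertex};
  _ : forall e, (0 < #|ends e| <= 2)%N
}.

Section Graph.

Variable G : mgraph.
Implicit Types (u v : vertex G) (A C : {set edge G}).

Definition adjacent A u v := [exists e in A, ends e == [set u; v]].

Definition components A : nat := n_comp (adjacent A) (vertex G).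

(* The walk u, e1, v1, e2, v2, ... is encoded by its initial vertex u and the
   sequence of pairs (e1, v1), (e2, v2), ... *)
Fixpoint walk u (s : seq (edge G * vertex G)) : bool :=
  if s is (e, v) :: s' then (ends e == [set u; v]) && walk v s' else true.

Definition steps_edges (s : seq (edge G * vertex G)) := [seq p.1 | p <- s].
Definition steps_vertices (s : seq (edge G * vertex G)) := [seq p.2 | p <- s].

Definition open_path u v s :=
  [&& walk u s, last u (steps_vertices s) == v, u != v
    & uniq (u :: steps_vertices s)].

(* The distinctness of the edges only matters in length 2, where it excludes
   going back and forth along a single edge. *)
Definition closed_path u s :=
  [&& walk u s, last u (steps_vertices s) == u, s != [::],
      uniq (steps_vertices s) & uniq (steps_edges s)].

(* A closed path has distinct edges, so its length is the size of its edge set;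
   see [circleP]. *)
Definition circle C : bool :=
  [exists u, exists s : #|C|.-tuple (edge G * vertex G),
     closed_path u s && (C == [set:: steps_edges s])].

Lemma circleP C :
  reflect (exists u s, closed_path u s /\ C = [set:: steps_edges s]) (circle C).
Proof.
apply: (iffP existsP) => [[u /existsP[s /andP[us /eqP Cs]]]|[u [s [us Cs]]]].
  by exists u, s.
exists u; apply/existsP.
have sz_s : size s == #|C|.
  have /and5P[_ _ _ _ Us] := us.
  by rewrite Cs cardsE (card_uniqP Us) size_map eqxx.
by exists (Tuple sz_s); rewrite us; apply/eqP.
Qed.

Definition internal_vertices u s := behead (belast u (steps_vertices s)).

Definition internally_disjoint u s t :=
  ~~ has (mem (steps_edges s)) (steps_edges t) &&
  ~~ has (mem (internal_vertices u s)) (internal_vertices u t).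

(* A theta graph, given by its edge set. *)
Definition theta_graph A : Prop :=
  exists u v p q r,
    [/\ [/\ open_path u v p, open_path u v q & open_path u v r],
        [/\ internally_disjoint u p q, internally_disjoint u p r
          & internally_disjoint u q r]
      & A = [set:: steps_edges p] :|: [set:: steps_edges q]
              :|: [set:: steps_edges r]].

Definition theta_property (B : {set {set edge G}}) : Prop :=
  forall A C1 C2 C3, theta_graph A ->
    [/\ circle C1, circle C2 & circle C3] ->
    [/\ C1 \subset A, C2 \subset A & C3 \subset A] ->
    [/\ C1 != C2, C1 != C3 & C2 != C3] ->
    C1 \in B -> C2 \in B -> C3 \in B.

End Graph.

Record biasedGraph := BiasedGraph {
  bg_graph :> mgraph;
  balanced_circles : {set {set edge bg_graph}};
  _ : forall C, C \in balanced_circles -> circle C;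
  _ : theta_property balanced_circles
}.

Section Biased.

Variable Omega : biasedGraph.
Implicit Type A : {set edge Omega}.

Definition balanced A :=
  [forall C : {set edge Omega},
     circle C && (C \subset A) ==> (C \in balanced_circles Omega)].

Definition balanced_sets : {set {set edge Omega}} := [set A | balanced A].

(* The truncated subtraction is exact: there are at most as many components as
   vertices.  Only the values on balanced sets are meaningful. *)
Definition rk A : nat := (#|vertex Omega| - components A)%N.

Definition rank : nat := (\max_(A in balanced_sets) rk A)%N.

(* In {poly {poly int}}, x is the outer variable 'X and y is the inner variable
   'X%:P.  The exponents are exact subtractions on balanced sets. *)
Definition balanced_tutte : {poly {poly int}} :=
  \sum_(A in balanced_sets)
    ('X - 1) ^+ (rank - rk A) * ('X%:P - 1) ^+ (#|A| - rk A).

Definition tutte_coef (i j : nat) : int := balanced_tutte`_i`_j.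

Definition nb_balanced (n : nat) : nat :=
  #|[set A in balanced_sets | #|A| == n]|.

End Biased.

Definition zbinom (a b : int) : rat :=
  match b with
  | Posz m => (\prod_(0 <= i < m) (a - i%:Z)%:~R) / m`!%:R
  | Negz _ => 0
  end.

(* Main.v *)
Require Import Defs.
From mathcomp Require Import all_boot all_order all_algebra.
From mathcomp Require Import zify ring.

(** The left-hand side is linear in the balanced Tutte polynomial.  On a monomial
    x^i y^j it takes the value (-1)^j C(k-i, j), which is the coefficient of z^k
    in z^i (-z)^j / (1-z)^(j+1): so it extracts the coefficient of z^k after the
    substitution x = z, y = -z/(1-z) and division by 1-z.  Under this substitution
    x-1 = -(1-z) and y-1 = -1/(1-z), hence the term (x-1)^a (y-1)^b of a balanced
    set A contributes the coefficient of z^k in (-1)^(a+b) (1-z)^(a-b-1), that is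
    (-1)^(a+b) C(k+b-a, k) ([tutte_sum_term]).  No power series are needed:
    multiplying by x-1 = z-1 or by y-1 = -1/(1-z) turns into a Pascal-type
    recurrence for the coefficients.

    Here a = r - rk A and b = |A| - rk A, where r is the rank of the biased graph,
    so a + b = r + |A| modulo 2 and b - a = |A| - r: the contribution of A depends
    only on |A|, and grouping balanced sets by size gives the right-hand side.

    Two facts on components make this legitimate.  First, the exponents are true
    subtractions, which requires rk A <= |A| ([card_vertex_le]): adding an edge
    merges at most two components.  Second, r = |V| - c(E) ([rank_components]):
    a minimal edge set with as many components as E contains no circle, because
    an edge of a circle can be removed without disconnecting anything, and a set
    without circles is balanced. *)

Import GRing.Theory.
Local Open Scope ring_scope.

(** * Binomial coefficients with integer upper index *)

Local Arguments zbinom : simpl never.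

Lemma zbinom0 a : zbinom a 0%:Z = 1.
Proof. by rewrite /zbinom big_geq // fact0 divr1. Qed.

Lemma zbinomS a m : zbinom (a + 1) m.+1 = zbinom a m.+1 + zbinom a m.
Proof.
rewrite /zbinom /=.
have prodS : \prod_(0 <= i < m.+1) (a + 1 - i%:Z)%:~R =
    (a + 1)%:~R * \prod_(0 <= i < m) (a - i%:Z)%:~R :> rat.
  rewrite big_nat_recl // subr0; congr (_ * _).
  by apply: eq_bigr => i _; congr _%:~R; lia.
rewrite prodS big_nat_recr //= factS natrM.
set p := \prod_(0 <= i < m) _.
have m1_neq0 : m.+1%:R != 0 :> rat by rewrite Num.Theory.pnatr_eq0.
have mf_neq0 : m`!%:R != 0 :> rat.
  by rewrite Num.Theory.pnatr_eq0 -lt0n fact_gt0.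
rewrite !rmorphD rmorphN /=.
field.
by rewrite mf_neq0 addrC natr1 m1_neq0.
Qed.

Lemma zbinom_nat (n m : nat) : zbinom n m = 'C(n, m)%:R.
Proof.
elim: n m => [|n IHn] [|m]; rewrite ?zbinom0 ?bin0 //.
  by rewrite /zbinom big_nat_recl // subr0 !mul0r.
by rewrite -[n.+1]addn1 PoszD zbinomS !IHn addn1 binS natrD.
Qed.

(** * The linear functionals that extract coefficients *)

(** The coefficient of z^m in q(-z/(1-z)) / (1-z). *)
Definition binomial_sum (m : nat) (q : {poly int}) : int :=
  \sum_(0 <= j < m.+1) (-1) ^+ j * 'C(m, j)%:R * q`_j.

Lemma binomial_sumB m q1 q2 :
  binomial_sum m (q1 - q2) = binomial_sum m q1 - binomial_sum m q2.
Proof.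
by rewrite -sumrB; apply: eq_bigr => j _; rewrite coefB mulrBr.
Qed.

(** Substituting y = -z/(1-z) gives (1-z) y = -z, whence the recurrence; on
    coefficients it is Pascal's rule. *)
Lemma binomial_sumXM m q :
  binomial_sum m.+1 ('X * q) = binomial_sum m ('X * q) - binomial_sum m q.
Proof.
rewrite /binomial_sum big_nat_recl // [in RHS]big_nat_recl // !coefXM /=.
rewrite !mulr0 !add0r.
have -> : \sum_(0 <= i < m) (-1) ^+ i.+1 * 'C(m, i.+1)%:R * ('X * q)`_i.+1 =
   \sum_(0 <= i < m.+1) (-1) ^+ i.+1 * 'C(m, i.+1)%:R * ('X * q)`_i.+1.
  (* The extra term, at i = m, vanishes since 'C(m, m.+1) = 0. *)
  by rewrite [in RHS]big_nat_recr //= bin_small // mulr0 mul0r addr0.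
rewrite -sumrB; apply: eq_bigr => j _.
by rewrite coefXM /= binS natrD exprS; ring.
Qed.

(** The coefficient form of (1-z)(y-1) = -1. *)
Lemma binomial_sum_Xsub1 m q :
  binomial_sum m.+1 (('X - 1) * q) =
  binomial_sum m (('X - 1) * q) - binomial_sum m.+1 q.
Proof. by rewrite mulrBl mul1r !binomial_sumB binomial_sumXM; ring. Qed.

(** The coefficient of z^m in (-1)^b (1-z)^(-b-1).  The recurrence of
    [binomial_sum_Xsub1] lowers either m or b, hence the nested inductions. *)
Lemma binomial_sum_Xsub1_exp m b :
  binomial_sum m (('X - 1) ^+ b) = (-1) ^+ b * 'C(m + b, m)%:R.
Proof.
elim: m b => [|m IHm] b.
  rewrite /binomial_sum big_nat1 !bin0 !mul1r mulr1 -horner_coef0.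
  by rewrite !hornerE.
elim: b => [|b IHb].
  rewrite expr0 /binomial_sum big_nat_recl // coef1 addn0 binn !mul1r.
  by rewrite big1 ?addr0 ?bin0 // => j _; rewrite coef1 mulr0.
rewrite exprS binomial_sum_Xsub1 -exprS IHm IHb [in RHS]addSn [in RHS]binS natrD.
by rewrite addnS addSn exprS; ring.
Qed.

(** The coefficient of z^k in P(z, -z/(1-z)) / (1-z). *)
Definition tutte_sum (k : nat) (P : {poly {poly int}}) : int :=
  \sum_(0 <= i < k.+1) binomial_sum (k - i) P`_i.

Lemma tutte_sumB k P Q : tutte_sum k (P - Q) = tutte_sum k P - tutte_sum k Q.
Proof.
by rewrite -sumrB; apply: eq_bigr => i _; rewrite coefB binomial_sumB.
Qed.

Lemma binomial_sum0 m : binomial_sum m 0 = 0.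
Proof. by rewrite -(subrr 0) binomial_sumB subrr. Qed.

Lemma tutte_sum0 k : tutte_sum k 0 = 0.
Proof. by rewrite -(subrr 0) tutte_sumB subrr. Qed.

Lemma tutte_sum_sum k (I : finType) (D : pred I) (P : I -> {poly {poly int}}) :
  tutte_sum k (\sum_(i | D i) P i) = \sum_(i | D i) tutte_sum k (P i).
Proof.
apply: (big_morph (tutte_sum k) _ (tutte_sum0 k)) => Q R.
by rewrite -{1}[R]opprK -[- R]sub0r !tutte_sumB tutte_sum0 sub0r opprK.
Qed.

(** In degree 0 the substitution x = z makes x vanish. *)
Lemma tutte_sum_Xsub1_0 P : tutte_sum 0 (('X - 1) * P) = - tutte_sum 0 P.
Proof.
rewrite mulrBl mul1r tutte_sumB {1}/tutte_sum big_nat1 coefXM /=.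
by rewrite binomial_sum0 sub0r.
Qed.

Lemma tutte_sum_Xsub1 k P :
  tutte_sum k.+1 (('X - 1) * P) = tutte_sum k P - tutte_sum k.+1 P.
Proof.
rewrite mulrBl mul1r tutte_sumB {1}/tutte_sum big_nat_recl // coefXM /=.
rewrite binomial_sum0 add0r; congr (_ - _).
by apply: eq_bigr => i _; rewrite coefXM.
Qed.

(** The coefficient of z^k in (-1)^(a+b) (1-z)^(a-b-1).  The upper index k+b-a may
    be negative; the recurrence in a is Pascal's rule, which holds for every
    integer upper index. *)
Lemma tutte_sum_term k a b :
  (tutte_sum k (('X - 1) ^+ a * ('X%:P - 1) ^+ b))%:~R =
  (-1) ^+ (a + b) * zbinom (k%:Z + b%:Z - a%:Z) k :> rat.
Proof.
elim: a k => [|a IHa] k.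
  rewrite expr0 mul1r -polyC1 -polyCB -polyC_exp subr0 -PoszD zbinom_nat add0n.
  rewrite /tutte_sum big_nat_recl // subn0 coefC /= big1 ?addr0 => [|i _].
    by rewrite binomial_sum_Xsub1_exp !rmorphM rmorphXn /= rmorphN1 natz.
  by rewrite coefC /= binomial_sum0.
rewrite exprS -mulrA addSn [in RHS]exprS.
case: k => [|k].
  by rewrite tutte_sum_Xsub1_0 rmorphN /= IHa !zbinom0 !mulr1 mulN1r.
rewrite tutte_sum_Xsub1 rmorphB /= !IHa.
have -> : k.+1%:Z + b%:Z - a%:Z = (k%:Z + b%:Z - a%:Z) + 1 by lia.
have -> : k.+1%:Z + b%:Z - a.+1%:Z = k%:Z + b%:Z - a%:Z by lia.
by rewrite zbinomS; ring.
Qed.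

(** * Components and edge sets *)

Section Components.

Variables (T : finType) (e e' : rel T).
Hypotheses (sym_e : connect_sym e) (sym_e' : connect_sym e').

(** Sending a root for e to its root for e' is injective on the roots that e' does
    not newly connect.  The exceptional set D allows for the components merged by
    an added edge; with D empty this is monotonicity. *)
Lemma n_comp_le_of_separated (D : {pred T}) :
    {in [predD roots e & D] &, forall x y,
       connect e' x y -> connect e x y} ->
  (n_comp e T <= n_comp e' T + #|D|)%N.
Proof.
move=> sepD; rewrite /n_comp_mem.
set A := [predD roots e & D] in sepD.
have leA : (#|A| <= #|predI (roots e') T|)%N.
  rewrite -(card_in_image (f := fingraph.root e') (A := A)).
    apply/subset_leq_card/subsetP => _ /imageP[x _ ->].
    by rewrite !inE andbT roots_root.
  move=> x y Ax Ay /(fingraph.rootP sym_e') /(sepD x y Ax Ay).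
  move/(fingraph.rootP sym_e).
  by move: Ax Ay => /andP[_ /eqP->] /andP[_ /eqP->].
rewrite addnC -(cardID D (predI (roots e) T)) leq_add //.
  by apply/subset_leq_card/subsetP => x /andP[].
apply: leq_trans leA; apply/subset_leq_card/subsetP => x.
by rewrite !inE andbT.
Qed.

End Components.

Section Graph.

Variable G : mgraph.
Implicit Types (u v x y : vertex G) (e : edge G) (A B C : {set edge G}).

Lemma adjacent_sym A : symmetric (adjacent A).
Proof. by move=> u v; rewrite /adjacent setUC. Qed.

Lemma connect_adjacent_sym A : connect_sym (adjacent A).
Proof. exact/sym_connect_sym/adjacent_sym. Qed.
Hint Resolve connect_adjacent_sym : core.

Lemma ends_pair e : exists u v, ends e = [set u; v].
Proof.
case: G e => V E f card_f e /=.
have /andP[] := card_f e.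
case: (ltngtP #|f e| 2) => // [lt2 gt0 _|/eqP/cards2P[u [v [_ ->]]] _ _].
  have /cards1P[u ->] : #|f e| == 1%N by rewrite eqn_leq gt0 andbT -ltnS.
  by exists u, u; rewrite setUid.
by exists u, v.
Qed.

Lemma connect_adjacentS A B : A \subset B ->
  subrel (connect (adjacent A)) (connect (adjacent B)).
Proof.
move=> sAB; apply: connect_sub => x y /exists_inP[e Ae exy].
by apply/connect1/exists_inP; exists e; rewrite // (subsetP sAB).
Qed.

Lemma components_le A B : A \subset B -> (components B <= components A)%N.
Proof.
move=> sAB.
have := @n_comp_le_of_separated _ (adjacent B) (adjacent A)
  (connect_adjacent_sym _) (connect_adjacent_sym _) pred0.
rewrite card0 addn0; apply=> x y _ _; exact: connect_adjacentS.
Qed.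

Lemma components_le_vertex A : (components A <= #|vertex G|)%N.
Proof. exact: max_card. Qed.

(** A path through the new edge uv joins points of the components of u and v, so
    two points it newly connects cannot both lie outside the component of u. *)
Lemma connect_add_edge A e u v x y : ends e = [set u; v] ->
    ~~ connect (adjacent A) u x -> ~~ connect (adjacent A) u y ->
  connect (adjacent (e |: A)) x y -> connect (adjacent A) x y.
Proof.
move=> euv nux nuy xy.
pose near z := connect (adjacent A) u z || connect (adjacent A) v z.
pose reach z := connect (adjacent A) x z || (near x && near z).
have near_conn z t : connect (adjacent A) z t -> near z = near t.
  by move=> zt; rewrite /near !(same_connect_r (connect_adjacent_sym _) zt).
have reachE z : (z \in reach) = connect (adjacent A) x z || (near x && near z).
  by [].
(* The components of u and v together form one component of e |: A. *)
have reach_closed : closed (adjacent (e |: A)) reach.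
  apply: intro_closed => [|z t /exists_inP[f]]; first exact: connect_adjacent_sym.
  rewrite !inE => /orP[/eqP->|Af] /eqP fzt; last first.
    have zt : connect (adjacent A) z t.
      by apply/connect1/exists_inP; exists f; rewrite ?fzt.
    rewrite !reachE (near_conn _ _ zt) => /orP[xz|->]; last by rewrite orbT.
    by rewrite (connect_trans xz zt).
  have near_end w : w \in ends e -> near w.
    rewrite euv !inE /near => /orP[]/eqP->; first by rewrite connect0.
    by rewrite connect0 orbT.
  have nz : near z by rewrite near_end // fzt !inE eqxx.
  have nt : near t by rewrite near_end // fzt !inE eqxx orbT.
  rewrite !reachE => /orP[/near_conn ->|/andP[-> _]]; first by rewrite nz nt orbT.
  by rewrite nt orbT.
have : y \in reach.
  by rewrite -(closed_connect reach_closed xy) reachE connect0.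
rewrite reachE /near (negPf nux) (negPf nuy) /= => /orP[//|/andP[vx vy]].
by apply: connect_trans vy; rewrite connect_adjacent_sym.
Qed.

Lemma components_set0 : components (set0 : {set edge G}) = #|vertex G|.
Proof.
apply: eq_card => x; rewrite !inE andbT.
apply/eqP/esym; have /connectP[[|y p] /= xp -> //] := connect_root (adjacent set0) x.
by case/andP: xp => /exists_inP[e]; rewrite inE.
Qed.

(** Only the root of the component of one end of e may have to be discarded. *)
Lemma components_add_edge A e : (components A <= components (e |: A) + 1)%N.
Proof.
have [u [v euv]] := ends_pair e.
have := @n_comp_le_of_separated _ (adjacent A) (adjacent (e |: A))
  (connect_adjacent_sym _) (connect_adjacent_sym _)
  (pred1 (fingraph.root (adjacent A) u)).
rewrite card1; apply=> x y.
have notin z : z \in [predD roots (adjacent A) & pred1 (fingraph.root (adjacent A) u)] ->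
    ~~ connect (adjacent A) u z.
  by rewrite !inE => /andP[zu /eqP rz]; rewrite -root_connect // rz eq_sym.
by move=> /notin nx /notin ny; apply: connect_add_edge euv _ _.
Qed.

(** Equivalently rk A <= |A|, so that the exponent of y-1 is an exact
    subtraction. *)
Lemma card_vertex_le A : (#|vertex G| <= components A + #|A|)%N.
Proof.
have [n leAn] := ubnP #|A|; elim: n A leAn => // n IHn A leAn.
have [->|[e Ae]] := set_0Vmem A; first by rewrite components_set0 leq_addr.
have := components_add_edge (A :\ e) e; have := IHn (A :\ e).
rewrite setD1K // (cardsD1 e A) Ae; move: leAn; rewrite (cardsD1 e A) Ae.
by lia.
Qed.

Lemma connect_walk A u s : walk u s -> {subset steps_edges s <= A} ->
  connect (adjacent A) u (last u (steps_vertices s)).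
Proof.
elim: s u => [|[e v] s IHs] u /=; first by rewrite connect0.
case/andP=> euv vs sA; apply: (connect_trans (y := v)).
  by apply/connect1/exists_inP; exists e; rewrite ?sA // mem_head.
by apply: IHs => // f sf; rewrite sA // inE sf orbT.
Qed.

(** The rest of the circle joins the ends of its first edge. *)
Lemma circle_redundant_edge A C : circle C -> C \subset A ->
  exists2 e, e \in A &
    connect (adjacent (A :\ e)) =2 connect (adjacent A).
Proof.
case/circleP=> u [s [us DC]] sCA; case/and5P: us => + + + _.
case: s DC => [|[e v] s] //= DC /andP[/eqP euv vs] /eqP lastu _ /andP[nes _].
have sA f : f \in e :: steps_edges s -> f \in A.
  by move=> sf; rewrite (subsetP sCA) // DC inE.
(* The remaining walk avoids e because the edges of a circle are distinct. *)
have vu : connect (adjacent (A :\ e)) v u.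
  rewrite -lastu; apply: connect_walk => // f sf.
  rewrite !inE sA ?inE ?sf ?orbT // andbT.
  by apply: contraNneq nes => <-.
exists e; first by rewrite sA ?mem_head.
move=> x y; apply/idP/idP; first by apply: connect_adjacentS; rewrite subsetDl.
apply: connect_sub => {}x {}y /exists_inP[f Af /eqP fxy].
have [fe|nfe] := eqVneq f e; last first.
  by apply/connect1/exists_inP; exists f; rewrite ?fxy // !inE nfe.
have endP z : z \in ends e -> connect (adjacent (A :\ e)) u z.
  rewrite euv !inE => /orP[]/eqP->; first exact: connect0.
  by rewrite connect_adjacent_sym.
move: fxy; rewrite fe => exy.
apply: (connect_trans (y := u)); last by rewrite endP // exy !inE eqxx orbT.
by rewrite connect_adjacent_sym endP // exy !inE eqxx.
Qed.

(** A minimal edge set with the component number of the whole graph contains no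
    circle, since it has no redundant edge. *)
Lemma spanning_forest_exists :
  exists2 F : {set edge G}, forall C, C \subset F -> ~~ circle C &
    components F = components [set: edge G].
Proof.
pose spanning (F : {set edge G}) := components F == components [set: edge G].
have : spanning [set: edge G] by rewrite /spanning.
case/minset_exists => F /minsetP[/eqP spF minF] _; exists F => // C sCF.
apply/negP=> /circle_redundant_edge/(_ sCF)[e Fe connE].
have spFe : spanning (F :\ e).
  by rewrite /spanning -spF; apply/eqP/eq_n_comp.
by have := minF _ spFe (subsetDl _ _) => /setP/(_ e); rewrite !inE eqxx Fe.
Qed.

End Graph.

(** Fewer edges give more components, which bounds the rank; a spanning forest is
    vacuously balanced and attains the bound. *)
Lemma rank_components (Omega : biasedGraph) :
  rank Omega = (#|vertex Omega| - components [set: edge Omega])%N.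
Proof.
apply/eqP; rewrite eqn_leq; apply/andP; split.
  by apply/bigmax_leqP => A _; rewrite leq_sub2l // components_le ?subsetT.
have [F noC <-] := spanning_forest_exists Omega.
rewrite /rank (bigD1 F) /= ?leq_maxl // inE.
by apply/forallP => C; apply/implyP => /andP[cC /noC]; rewrite cC.
Qed.

(** * The coefficient identity *)

Lemma zbinom_subn (k i j : nat) : (i <= k)%N ->
  zbinom (k%:Z - i%:Z) j%:Z = 'C(k - i, j)%:R.
Proof. by move=> leik; rewrite subzn // zbinom_nat. Qed.

Theorem corollary3p6 (Omega : biasedGraph) (k : nat) :
  \sum_(0 <= i < k.+1) \sum_(0 <= j < (k - i).+1)
     zbinom (k%:Z - i%:Z) j%:Z * (-1) ^+ j * (tutte_coef Omega i j)%:~R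
  = \sum_(0 <= n < #|edge Omega|.+1)
     (-1) ^+ (#|vertex Omega| - components [set: edge Omega] + n)
       * (nb_balanced Omega n)%:R
       * zbinom (k%:Z + n%:Z - #|vertex Omega|%:Z
                   + (components [set: edge Omega])%:Z) k%:Z :> rat.
Proof.
have -> : \sum_(0 <= i < k.+1) \sum_(0 <= j < (k - i).+1)
     zbinom (k%:Z - i%:Z) j%:Z * (-1) ^+ j * (tutte_coef Omega i j)%:~R
    = (tutte_sum k (balanced_tutte Omega))%:~R :> rat.
  rewrite /tutte_sum rmorph_sum; apply: eq_big_nat => i /andP[_ lt_ik].
  rewrite rmorph_sum; apply: eq_bigr => j _.
  rewrite zbinom_subn // !rmorphM rmorphXn /= rmorphN1 natz.
  by congr (_ * _); rewrite mulrC.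
rewrite tutte_sum_sum rmorph_sum /=.
set V := #|vertex Omega|; set c := components [set: edge Omega].
pose term n : rat := (-1) ^+ (V - c + n) *
  zbinom (k%:Z + n%:Z - V%:Z + c%:Z) k%:Z.
transitivity (\sum_(A in balanced_sets Omega) term #|A|).
  apply: eq_bigr => A _; rewrite tutte_sum_term /rk rank_components -/V -/c /term.
  have le_cA : (c <= components A)%N by rewrite components_le ?subsetT.
  have le_AV : (components A <= V)%N := components_le_vertex _ A.
  have le_VA : (V <= components A + #|A|)%N := card_vertex_le _ A.
  (* The two exponents of -1 differ by twice the rank of A. *)
  congr (_ * zbinom _ _); last by lia.
  rewrite -signr_odd -[RHS]signr_odd; congr (_ ^+ nat_of_bool _); lia.
rewrite (partition_big
  (fun A : {set edge Omega} => inord #|A| : 'I_#|edge Omega|.+1) xpredT) //=.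
rewrite big_mkord; apply: eq_bigr => n _.
rewrite /nb_balanced mulrAC -/(term n) mulr_natr -sumr_const.
have inordE (A : {set edge Omega}) :
    (inord #|A| == n :> 'I_#|edge Omega|.+1) = (#|A| == n).
  by rewrite -val_eqE /= inordK // ltnS max_card.
apply: eq_big => A; first by rewrite inE inordE.
by rewrite inordE => /andP[_ /eqP->].
Qed.
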